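(* Let $R$ be a finite commutative ring, $V$ a finite $R$-module, $Q$ a probability on $R$, $P$ the uniform distribution on $V$, and $\alpha\in[0,1]$. For a cyclic submodule $W$ of $\widehat V$ and a character $\rho$ of $U(R)$ that factors through $\pi_W\colon U(R)\to U(R/\mathrm{ann}(W))$, define \[\lambda_{([W],\rho)}=\begin{cases}1,&W=0,\\(1-\alpha)\sum_{a\in U(R)+\mathrm{ann}(W)}Q(a)\rho(u_W(a)),&W\neq0,\end{cases}\] where $u_W(a)\in U(R)$ satisfies $u_W(a)+\mathrm{ann}(W)=a+\mathrm{ann}(W)$. Then the multiset of eigenvalues of the transition matrix of the coin-toss walk on $V$ (driven by $P$ and $Q$, heads probability $\alpha$) is obtained by taking, for each isomorphism class $[W]$ of cyclic submodules of $\widehat V$ and each such $\rho$, the value $\lambda_{([W],\rho)}$ with multiplicity equal to the number of cyclic submodules of $\widehat V$ isomorphic to $W$.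
   Context: $U(S)$: unit group of a ring $S$ (the zero ring has trivial unit group); $\mathrm{ann}(W)=\{r\in R: rW=0\}$; $\pi_W$ is the natural map (which is surjective, so $u_W(a)$ exists and $\lambda$ does not depend on its choice). $\widehat V$: group of characters of $(V,+)$, an $R$-module via $(r\chi)(v)=\chi(rv)$. The transition matrix has $(x,y)$-entry the probability of moving from $x$ to $y$. Coin-toss walk: from $x\in V$, with probability $\alpha$ move to $x+b$ ($b$ chosen by $P$), with probability $1-\alpha$ move to $ax$ ($a$ chosen by $Q$). *)

(* Defs.v *)
From HB Require Import structures.
From mathcomp Require Import all_boot all_order all_algebra all_fingroup.
From mathcomp Require Import cyclic reals complex.

Set Implicit Arguments.
Unset Strict Implicit.
Unset Printing Implicit Defensive.

Import GRing.Theory Num.Theory FinRing.Theory.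
Local Open Scope ring_scope.

(* Rings are [finComPzRingType]s rather than [finComNzRingType]s throughout,
   because the zero ring is allowed (it also occurs as R / ann(0)).  The
   library's [finLmodType] and [{unit R}] both require 1 != 0, hence the two
   variants below. *)

Record finModType (R : pzRingType) : Type := FinModType {
  finmod_zmod : finZmodType;
  finmod_mixin : GRing.Zmodule_isLmodule R finmod_zmod
}.

Definition finmod_sort (R : pzRingType) (M : finModType R) : Type :=
  finmod_zmod M.
Coercion finmod_sort : finModType >-> Sortclass.

HB.instance Definition _ (R : pzRingType) (M : finModType R) :=
  FinRing.Zmodule.on (finmod_sort M).
HB.instance Definition _ (R : pzRingType) (M : finModType R) :
  GRing.Zmodule_isLmodule R (finmod_sort M) := finmod_mixin M.

Section UnitGroup.
Variable S : finComPzRingType.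

Definition is_unit (x : S) : bool := [exists y : S, x * y == 1].

Definition unit_group : Type := {x : S | is_unit x}.

HB.instance Definition _ := SubFinite.copy unit_group {x : S | is_unit x}.

Implicit Types u v w : unit_group.

Fact unit_group_one_subproof : is_unit (1 : S).
Proof. by apply/existsP; exists 1; rewrite mulr1. Qed.

Fact unit_group_mul_subproof u v : is_unit (val u * val v).
Proof.
have /existsP[x /eqP ux] := valP u; have /existsP[y /eqP vy] := valP v.
by apply/existsP; exists (x * y); rewrite mulrACA ux vy mulr1.
Qed.

Definition unit_group_one : unit_group := Sub 1 unit_group_one_subproof.
Definition unit_group_mul u v : unit_group :=
  Sub (val u * val v) (unit_group_mul_subproof u v).
Definition unit_group_inv u : unit_group :=
  odflt unit_group_one [pick v | unit_group_mul v u == unit_group_one].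

Fact unit_group_mulA : associative unit_group_mul.
Proof. by move=> u v w; apply: val_inj; rewrite /= mulrA. Qed.

Fact unit_group_mul1 : left_id unit_group_one unit_group_mul.
Proof. by move=> u; apply: val_inj; rewrite /= mul1r. Qed.

Fact unit_group_mulV : left_inverse unit_group_one unit_group_inv unit_group_mul.
Proof.
move=> u; rewrite /unit_group_inv; case: pickP => [v /eqP // | no_inv].
have /existsP[y /eqP uy] := valP u.
have Uy : is_unit y by apply/existsP; exists (val u); rewrite mulrC uy.
by have /eqP[] := no_inv (Sub y Uy); apply: val_inj; rewrite /= mulrC.
Qed.

HB.instance Definition _ := Finite_isGroup.Build unit_group
  unit_group_mulA unit_group_mul1 unit_group_mulV.

End UnitGroup.

Section Characters.
Variables (C : numClosedFieldType) (gT : finGroupType).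

(* Nonvanishing of f follows from the two conditions, so these are exactly the
   homomorphisms from gT to the multiplicative group of C. *)
Definition is_gchar (f : {ffun gT -> C}) : bool :=
  (f 1%g == 1) && [forall x, forall y, f (x * y)%g == f x * f y].

Record gchar : Type := GChar {
  gchar_ffun :> {ffun gT -> C};
  gcharP : is_gchar gchar_ffun
}.

HB.instance Definition _ := [isSub for gchar_ffun].
HB.instance Definition _ := [Choice of gchar by <:].

Implicit Types rho : gchar.

Lemma gchar1 rho : rho 1%g = 1.
Proof. by have /andP[/eqP] := gcharP rho. Qed.

Lemma gcharM rho x y : rho (x * y)%g = rho x * rho y.
Proof. by have /andP[_ /forallP/(_ x)/forallP/(_ y)/eqP] := gcharP rho. Qed.

Lemma gcharX rho x n : rho (x ^+ n)%g = rho x ^+ n.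
Proof.
by elim: n => [|n IHn]; rewrite ?expg0 ?gchar1 // expgS exprS gcharM IHn.
Qed.

Lemma gchar_neq0 rho x : rho x != 0.
Proof.
apply/eqP=> rho_x0; have := gcharM rho x x^-1%g.
by rewrite mulgV gchar1 rho_x0 mul0r => /eqP; rewrite oner_eq0.
Qed.

Lemma gchar_eq rho1 rho2 : (forall x, rho1 x = rho2 x) -> rho1 = rho2.
Proof. by move=> eq12; apply: val_inj; apply/ffunP. Qed.

(* Finiteness: the values of a character are #|gT|-th roots of unity. *)
Let roots1 : seq C :=
  sval (closed_field_poly_normal ('X^#|gT| - 1 : {poly C})).

Fact gchar_root1 rho x : rho x \in roots1.
Proof.
have n_gt0 : (0 < #|gT|)%N by apply/card_gt0P; exists 1%g.
rewrite -root_prod_XsubC -(rootZ _ _ (oner_neq0 C)).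
rewrite -[X in X *: _](lead_coefXnsubC 1 n_gt0).
rewrite -(svalP (closed_field_poly_normal _)) rootE !hornerE.
by rewrite -gcharX -cardsT (expg_cardG (in_setT x)) gchar1 subrr.
Qed.

Definition gchar_code rho : {ffun gT -> seq_sub roots1} :=
  [ffun x => SeqSub (gchar_root1 rho x)].

Definition gchar_decode (c : {ffun gT -> seq_sub roots1}) : option gchar :=
  insub [ffun x => val (c x)].

Fact gchar_codeK : pcancel gchar_code gchar_decode.
Proof.
move=> rho; rewrite /gchar_decode (_ : [ffun x => _] = val rho) ?valK //.
by apply/ffunP=> x; rewrite !ffunE.
Qed.

HB.instance Definition _ := PCanIsCountable gchar_codeK.
HB.instance Definition _ : isFinite gchar := PCanIsFinite gchar_codeK.

End Characters.

Section Dual.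
Variables (C : numClosedFieldType) (R : finComPzRingType) (V : finModType R).

(* The character group of (V, +), written additively: the sum of two
   characters is their pointwise product, and (r *: chi) v = chi (r *: v). *)
Definition dual_sort : Type := gchar C (V : finZmodType).

HB.instance Definition _ := Finite.on dual_sort.

Implicit Types (chi psi : dual_sort) (r s : R) (v : V).

Fact dual_zero_subproof : is_gchar ([ffun=> 1] : {ffun V -> C}).
Proof.
by apply/andP; split; rewrite ?ffunE //; apply/forallP=> x;
   apply/forallP=> y; rewrite !ffunE mulr1.
Qed.

Fact dual_add_subproof chi psi :
  is_gchar ([ffun v => chi v * psi v] : {ffun V -> C}).
Proof.
apply/andP; split; first by rewrite ffunE !gchar1 mulr1.
by apply/forallP=> x; apply/forallP=> y; rewrite !ffunE !gcharM mulrACA.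
Qed.

Fact dual_opp_subproof chi : is_gchar ([ffun v => (chi v)^-1] : {ffun V -> C}).
Proof.
apply/andP; split; first by rewrite ffunE !gchar1 invr1.
by apply/forallP=> x; apply/forallP=> y; rewrite !ffunE !gcharM invfM.
Qed.

Fact dual_scale_subproof r chi :
  is_gchar ([ffun v : V => chi (r *: v)] : {ffun V -> C}).
Proof.
apply/andP; split; first by rewrite ffunE scaler0 gchar1.
apply/forallP=> x; apply/forallP=> y.
by rewrite !ffunE zmodMgE scalerDr -zmodMgE gcharM.
Qed.

Definition dual_zero : dual_sort := GChar dual_zero_subproof.
Definition dual_add chi psi : dual_sort := GChar (dual_add_subproof chi psi).
Definition dual_opp chi : dual_sort := GChar (dual_opp_subproof chi).
Definition dual_scale r chi : dual_sort := GChar (dual_scale_subproof r chi).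

Fact dual_addA : associative dual_add.
Proof. by move=> x y z; apply: gchar_eq => v; rewrite !ffunE mulrA. Qed.

Fact dual_addC : commutative dual_add.
Proof. by move=> x y; apply: gchar_eq => v; rewrite !ffunE mulrC. Qed.

Fact dual_add0 : left_id dual_zero dual_add.
Proof. by move=> x; apply: gchar_eq => v; rewrite !ffunE mul1r. Qed.

Fact dual_addN : left_inverse dual_zero dual_opp dual_add.
Proof.
by move=> x; apply: gchar_eq => v; rewrite !ffunE mulVf ?gchar_neq0.
Qed.

HB.instance Definition _ :=
  GRing.isZmodule.Build dual_sort dual_addA dual_addC dual_add0 dual_addN.

Fact dual_scaleA r s chi :
  dual_scale r (dual_scale s chi) = dual_scale (r * s) chi.
Proof. by apply: gchar_eq => v; rewrite !ffunE scalerA mulrC. Qed.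

Fact dual_scale1 : left_id 1 dual_scale.
Proof. by move=> chi; apply: gchar_eq => v; rewrite !ffunE scale1r. Qed.

Fact dual_scaleDr : right_distributive dual_scale +%R.
Proof. by move=> r chi psi; apply: gchar_eq => v; rewrite !ffunE. Qed.

Fact dual_scaleDl chi : {morph dual_scale^~ chi : r s / r + s}.
Proof.
by move=> r s; apply: gchar_eq => v; rewrite !ffunE scalerDl -zmodMgE gcharM.
Qed.

Definition dual : finModType R := FinModType
  (GRing.Zmodule_isLmodule.Build R dual_sort
     dual_scaleA dual_scale1 dual_scaleDr dual_scaleDl).

End Dual.

Section Submodules.
Variables (R : finComPzRingType) (M : finModType R).
Implicit Types W : {set M}.

Definition cyclic_submodules : {set {set M}} :=
  [set [set r *: x | r : R] | x : M].

(* W1 and W2 are isomorphic R-modules: some f, of which only the restriction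
   to W1 matters, is an R-linear bijection from W1 onto W2. *)
Definition module_iso W1 W2 : bool :=
  [exists f : {ffun M -> M},
    [&& f @: W1 == W2,
        dinjectiveb f (mem W1),
        [forall x in W1, forall y in W1, f (x + y) == f x + f y]
      & [forall r : R, forall x in W1, f (r *: x) == r *: f x]]].

Definition iso_classes : {set {set {set M}}} :=
  equivalence_partition module_iso cyclic_submodules.

Definition ann W : pred R := [pred r | [forall x in W, r *: x == 0]].

Fact ann_zmod_closed W : zmod_closed (ann W).
Proof.
split=> [|r s /forall_inP rW0 /forall_inP sW0]; apply/forall_inP=> x Wx.
  by rewrite scale0r.
by rewrite scalerBl (eqP (rW0 x Wx)) (eqP (sW0 x Wx)) subrr.
Qed.

HB.instance Definition _ W := GRing.isZmodClosed.Build R (ann W)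
  (ann_zmod_closed W).

Lemma ann_mull W r s : s \in ann W -> r * s \in ann W.
Proof.
move=> /forall_inP sW0; apply/forall_inP=> x Wx.
by rewrite -scalerA (eqP (sW0 x Wx)) scaler0.
Qed.

End Submodules.

Section AnnihilatorQuotient.
Local Open Scope quotient_scope.
Variables (R : finComPzRingType) (M : finModType R) (W : {set M}).

(* The ring R / ann(W): the library provides the additive quotient, but a ring
   structure only for proper ideals. *)
Let annW : zmodClosed R := GRing.ZmodClosed.clone R (ann W) _.

Definition ann_quot : Type := Quotient.quot annW.

HB.instance Definition _ : EqQuotient R (Quotient.equiv annW) ann_quot :=
  EqQuotient.on ann_quot.
HB.instance Definition _ := GRing.Zmodule.on ann_quot.
HB.instance Definition _ : isCountable ann_quot :=
  CanIsCountable (@reprK R ann_quot).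
HB.instance Definition _ : isFinite ann_quot :=
  CanIsFinite (@reprK R ann_quot).

Definition to_quot (r : R) : ann_quot := \pi_ann_quot r.
Definition quot_one : ann_quot := to_quot 1.
Definition quot_mul (x y : ann_quot) : ann_quot :=
  to_quot (generic_quotient.repr x * generic_quotient.repr y).

Lemma to_quotP r s : reflect (to_quot r = to_quot s) (r - s \in ann W).
Proof. by rewrite Quotient.idealrBE; apply: eqP. Qed.

Lemma to_quotK (x : ann_quot) : to_quot (generic_quotient.repr x) = x.
Proof. exact: reprK. Qed.

Lemma to_quotD r s : to_quot (r + s) = to_quot r + to_quot s.
Proof. exact: (@pi_addr _ _ _ _ _ ann_quot). Qed.

Lemma to_quotM r s : to_quot (r * s) = quot_mul (to_quot r) (to_quot s).
Proof.
have h t : t - generic_quotient.repr (to_quot t) \in ann W.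
  by apply/to_quotP; rewrite to_quotK.
apply/to_quotP.
set r' := generic_quotient.repr _; set s' := generic_quotient.repr _.
rewrite (_ : _ - _ = s * (r - r') + r' * (s - s')).
  by rewrite rpredD // ann_mull ?h.
by rewrite !mulrBr [s * r]mulrC [s * r']mulrC addrA subrK.
Qed.

Fact quot_mulA : associative quot_mul.
Proof.
move=> x y z; rewrite -[x]to_quotK -[y]to_quotK -[z]to_quotK.
by rewrite -!to_quotM mulrA.
Qed.

Fact quot_mulC : commutative quot_mul.
Proof. by move=> x y; rewrite /quot_mul mulrC. Qed.

Fact quot_mul1 : left_id quot_one quot_mul.
Proof. by move=> x; rewrite -[x]to_quotK -to_quotM mul1r. Qed.

Fact quot_mulDl : left_distributive quot_mul +%R.
Proof.
move=> x y z; rewrite -[x]to_quotK -[y]to_quotK -[z]to_quotK.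
by rewrite -to_quotD -!to_quotM -to_quotD mulrDl.
Qed.

HB.instance Definition _ := GRing.Zmodule_isComPzRing.Build ann_quot
  quot_mulA quot_mulC quot_mul1 quot_mulDl.

Fact unit_proj_subproof (u : unit_group R) : is_unit (to_quot (val u)).
Proof.
have /existsP[y /eqP uy] := valP u.
by apply/existsP; exists (to_quot y); rewrite -[_ * _]to_quotM uy.
Qed.

(* pi_W : U(R) -> U(R / ann(W)) *)
Definition unit_proj (u : unit_group R) : unit_group ann_quot :=
  Sub (to_quot (val u)) (unit_proj_subproof u).

Definition factors_through (C : numClosedFieldType)
    (rho : gchar C (unit_group R)) : bool :=
  [exists rho' : gchar C (unit_group ann_quot),
    [forall u : unit_group R, rho u == rho' (unit_proj u)]].

Definition units_plus_ann : {set R} :=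
  [set val u + z | u in [set: unit_group R], z in ann W].

(* u_W(a); the default value 1 is only reached when a is not in
   U(R) + ann(W). *)
Definition unit_lift (a : R) : unit_group R :=
  odflt 1%g [pick u : unit_group R | to_quot (val u) == to_quot a].

End AnnihilatorQuotient.

Section Walk.
Variable K : realType.

Definition is_probability (T : finType) (p : T -> K) : Prop :=
  (forall x, 0 <= p x) /\ \sum_x p x = 1.

Definition uniform (T : finType) : T -> K := fun=> #|T|%:R^-1.

Variables (R : finComPzRingType) (V : finModType R).

Definition coin_toss_step (P : V -> K) (Q : R -> K) (alpha : K) (x y : V) : K :=
  alpha * (\sum_(b : V | x + b == y) P b)
  + (1 - alpha) * (\sum_(a : R | a *: x == y) Q a).

Definition transition_matrix (T : finType) (step : T -> T -> K) : 'M[K]_#|T| :=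
  \matrix_(i, j) step (enum_val i) (enum_val j).

End Walk.

(* The eigenvalues in C of a square matrix, each repeated according to its
   algebraic multiplicity; only meaningful up to [perm_eq]. *)
Definition eigenvalue_seq (C : closedFieldType) (n : nat) (A : 'M[C]_n) :
    seq C :=
  sval (closed_field_poly_normal (char_poly A)).

Section Prediction.
Local Open Scope complex_scope.
Variables (K : realType) (R : finComPzRingType) (V : finModType R).
Variables (Q : R -> K) (alpha : K).

Definition lambda (W : {set dual K[i] V}) (rho : gchar K[i] (unit_group R)) :
    K[i] :=
  if W == [set 0] then 1
  else (1 - alpha)%:C
       * \sum_(a in units_plus_ann W) (Q a)%:C * rho (unit_lift W a).

(* Isomorphism classes are taken through a representative [rep c] of each
   class c of cyclic submodules of the dual. *)
Definition predicted_eigenvalues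
    (rep : {set {set dual K[i] V}} -> {set dual K[i] V}) : seq K[i] :=
  flatten
    [seq nseq #|[set W in cyclic_submodules (dual K[i] V)
                   | module_iso (rep c) W]|
           (lambda (rep c) rho)
       | c <- enum (iso_classes (dual K[i] V)),
         rho <- enum [set rho | factors_through (rep c) rho]].

End Prediction.

(* Main.v *)
Require Import Defs.
From mathcomp Require Import all_boot all_order all_algebra all_fingroup.
From mathcomp Require Import cyclic separable cyclotomic reals complex.

(* For a character chi of V and a character rho of U(R), consider the function
   f_rho(chi) = sum_u rho(u)^-1 (u chi) on V.  It satisfies
   f_rho(v chi) = rho(v) f_rho(chi) for every unit v, so it vanishes unless rho
   factors through pi_W, W = R chi, and up to scalars it depends only on
   (W, rho), because two generators of W differ by a unit of R (units lift along
   quotients of a finite commutative ring).  Fourier inversion on V and on U(R)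
   shows that the functions indexed by the pairs (W, rho) form a basis of the
   functions on V.  The walk maps f_rho(chi), chi != 0, to
   (1 - alpha) sum_a Q(a) f_rho(a chi): the a in U(R) + ann(W) contribute
   lambda_(W, rho) f_rho(chi), the other ones send chi into a smaller cyclic
   submodule.  Hence the walk is triangular in this basis, with diagonal entries
   lambda_(W, rho).  Finally cyclic modules are isomorphic exactly when they have
   the same annihilator, on which alone lambda depends. *)

Set Implicit Arguments.
Unset Strict Implicit.
Unset Printing Implicit Defensive.

Import GRing.Theory Num.Theory.
Local Open Scope ring_scope.

(** * Characters of finite abelian groups: separation and orthogonality *)

Lemma diagonalizable_of_finite_order (C : numClosedFieldType) (n m : nat)
    (A : 'M[C]_n) :
  (0 < m)%N -> A ^+ m = 1 -> diagonalizable A.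
Proof.
case: n A => [|n] A m_gt0 Am1.
  exists 1%:M; first exact: unitmx1.
  by apply/diagonalizable_forP; rewrite ?unitmx1 // => -[].
apply/diagonalizableP.
(* ['X^m - 1] is separable because [m] is nonzero in [C], so a matrix that it annihilates has a
   minimal polynomial with distinct roots. *)
have [rs Drs] := closed_field_poly_normal ('X^m - 1 : {poly C}).
rewrite (monicP _) ?monicXnsubC // scale1r in Drs.
exists rs.
  by rewrite -separable_prod_XsubC -Drs separable_Xn_sub_1 // pnatr_eq0 -lt0n.
rewrite -Drs; apply: mxminpoly_min.
by rewrite rmorphB rmorphXn /= horner_mx_X rmorph1 Am1 subrr.
Qed.

Section AbelianCharacters.
Variables (C : numClosedFieldType) (gT : finGroupType).
Implicit Types (x y z : gT) (rho sigma : gchar C gT).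

Definition regular_mx x : 'M[C]_#|gT| :=
  \matrix_(i, j) (enum_val i * x == enum_val j)%g%:R.

Lemma regular_mx1 : regular_mx 1%g = 1%:M.
Proof. by apply/matrixP=> i j; rewrite !mxE mulg1 (inj_eq enum_val_inj). Qed.

Lemma regular_mxM x y : regular_mx (x * y)%g = regular_mx x *m regular_mx y.
Proof.
apply/matrixP=> i j; rewrite !mxE (bigD1 (enum_rank (enum_val i * x)%g)) //=.
rewrite !mxE enum_rankK eqxx mul1r mulgA big1 ?addr0 // => k neq_k.
rewrite !mxE (negPf _ : _ == enum_val k = false) ?mul0r //.
by apply: contra neq_k => /eqP->; rewrite enum_valK.
Qed.

Lemma regular_mxX x n : regular_mx (x ^+ n)%g = regular_mx x ^+ n.
Proof.
elim: n => [|n IHn]; first exact: regular_mx1.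
by rewrite expgS exprS regular_mxM IHn.
Qed.

(** The row of the neutral element has its only 1 in the column of [x]: the regular representation
    is faithful. *)
Lemma regular_mx_eq1 x : regular_mx x = 1%:M -> x = 1%g.
Proof.
move/matrixP/(_ (enum_rank 1%g) (enum_rank x)); rewrite !mxE !enum_rankK mul1g.
rewrite eqxx; case: eqP => [/enum_rank_inj // | _] /eqP.
by rewrite oner_eq0.
Qed.

(* The regular representation of an abelian group is simultaneously
   diagonalizable, and its diagonal entries are characters. *)
Lemma gchar_separation x : (forall y z, commute y z) -> x != 1%g ->
  exists rho, rho x != 1.
Proof.
move=> abG x1; apply/existsP; apply: contraR x1.
rewrite negb_exists => /forallP no_rho; apply/eqP.
have [|P Pu /allP PA] := (codiagonalizableP [seq regular_mx y | y : gT]).1.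
  split=> [_ _ /imageP[y _ ->] /imageP[z _ ->] | _ /imageP[y _ ->]].
    by rewrite /comm_mx -!regular_mxM abG.
  apply: (@diagonalizable_of_finite_order _ _ #|gT|).
    by apply/card_gt0P; exists 1%g.
  have y1 : (y ^+ #|gT| = 1)%g by rewrite -cardsT (expg_cardG (in_setT y)).
  by rewrite -regular_mxX y1; apply: regular_mx1.
pose D y := P *m regular_mx y *m invmx P.
have Ddiag y i j : i != j -> D y i j = 0.
  move=> neq_ij; have /PA : regular_mx y \in [seq regular_mx y | y : gT].
    exact: image_f.
  by move/diagonalizable_forP; apply.
have DM y z : D (y * z)%g = D y *m D z.
  by rewrite /D regular_mxM !mulmxA mulmxKV.
have D1 : D 1%g = 1%:M by rewrite /D regular_mx1 mulmx1 mulmxV.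
have chiP i : is_gchar ([ffun y => D y i i] : {ffun gT -> C}).
  apply/andP; split; first by rewrite ffunE D1 mxE eqxx.
  apply/forallP=> y; apply/forallP=> z; rewrite !ffunE DM mxE (bigD1 i) //=.
  by rewrite big1 ?addr0 // => k ki; rewrite Ddiag ?mul0r // eq_sym.
(* By [no_rho], all diagonal characters take the value 1 at [x]. *)
have Dx : D x = 1%:M.
  apply/matrixP=> i j; rewrite [RHS]mxE; have [<- | /Ddiag-> //] := eqVneq i j.
  by have := no_rho (GChar (chiP i)); rewrite /= negbK ffunE => /eqP.
apply: regular_mx_eq1; rewrite -[LHS](mulKmx Pu) -[P *m _](mulmxKV Pu).
by rewrite [_ *m invmx P]Dx mul1mx mulVmx.
Qed.

Fact gchar_mul_subproof rho sigma :
  is_gchar ([ffun x => rho x * sigma x] : {ffun gT -> C}).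
Proof.
apply/andP; split; first by rewrite ffunE !gchar1 mulr1.
by apply/forallP=> x; apply/forallP=> y; rewrite !ffunE !gcharM mulrACA.
Qed.

Definition gchar_mul rho sigma : gchar C gT := GChar (gchar_mul_subproof rho sigma).

Fact gchar_inv_subproof rho : is_gchar ([ffun x => (rho x)^-1] : {ffun gT -> C}).
Proof.
apply/andP; split; first by rewrite ffunE !gchar1 invr1.
by apply/forallP=> x; apply/forallP=> y; rewrite !ffunE !gcharM invfM.
Qed.

Definition gchar_inv rho : gchar C gT := GChar (gchar_inv_subproof rho).

Lemma gcharV rho x : rho x^-1%g = (rho x)^-1.
Proof.
by apply: (mulfI (gchar_neq0 rho x)); rewrite -gcharM mulgV gchar1 divff ?gchar_neq0.
Qed.

Lemma gchar_mulK rho : cancel (gchar_mul rho) (gchar_mul (gchar_inv rho)).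
Proof.
by move=> sigma; apply: gchar_eq => x; rewrite !ffunE mulKf ?gchar_neq0.
Qed.

Lemma gchar_mulVK rho : cancel (gchar_mul (gchar_inv rho)) (gchar_mul rho).
Proof.
by move=> sigma; apply: gchar_eq => x; rewrite !ffunE mulVKf ?gchar_neq0.
Qed.

(** Common end of the orthogonality arguments, where reindexing a sum shows that it equals itself
    times a character value other than 1. *)
Lemma mul_fixed_eq0 (a s : C) : a != 1 -> a * s = s -> s = 0.
Proof.
move=> a_neq1 /eqP; rewrite -subr_eq0 -[X in _ - X]mul1r -mulrBl mulf_eq0 subr_eq0.
by rewrite (negPf a_neq1) => /eqP.
Qed.

Lemma gchar_sum_elements rho x : rho x != 1 -> \sum_y rho y = 0.
Proof.
move=> rhox; apply: (mul_fixed_eq0 rhox).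
rewrite mulr_sumr [RHS](reindex_inj (mulgI x)) /=.
by apply: eq_bigr => y _; rewrite gcharM.
Qed.

(** The quotient of two distinct characters is a nontrivial character, whose sum vanishes. *)
Lemma gchar_orthogonality rho sigma : rho <> sigma ->
  \sum_x rho x * (sigma x)^-1 = 0.
Proof.
move=> neq; have [x rsx] : exists x, rho x != sigma x.
  apply/existsP; apply: contra_notT neq; rewrite negb_exists => /forallP eq_rs.
  by apply: gchar_eq => x; apply/eqP; have := eq_rs x; rewrite negbK.
rewrite -[RHS](@gchar_sum_elements (gchar_mul rho (gchar_inv sigma)) x).
  by apply: eq_bigr => y _; rewrite !ffunE.
rewrite !ffunE; apply: contra rsx => /eqP rs1.
by rewrite -[rho x](mulfVK (gchar_neq0 sigma x)) rs1 mul1r.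
Qed.

(** Multiplication by a character that is not 1 at [x] permutes the characters and rescales the
    sum. *)
Lemma gchar_sum_characters x : (forall y z, commute y z) ->
  \sum_(rho : gchar C gT) rho x = (x == 1%g)%:R * #|{: gchar C gT}|%:R.
Proof.
move=> abG; have [-> | x1] := eqVneq.
  by rewrite (eq_bigr (fun=> 1)) ?sumr_const ?mul1r // => rho _; rewrite gchar1.
have [rho rhox] := gchar_separation abG x1.
rewrite mul0r; apply: (mul_fixed_eq0 rhox).
rewrite mulr_sumr [RHS](reindex (gchar_mul rho)); last first.
  by exists (gchar_mul (gchar_inv rho)) => s _; rewrite ?gchar_mulK ?gchar_mulVK.
by apply: eq_bigr => sigma _; rewrite ffunE.
Qed.

Lemma card_gchar_neq0 : #|{: gchar C gT}|%:R != 0 :> C.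
Proof.
have oneP : is_gchar ([ffun=> 1] : {ffun gT -> C}).
  apply/andP; split; rewrite ?ffunE //.
  by apply/forallP=> x; apply/forallP=> y; rewrite !ffunE mulr1.
by rewrite pnatr_eq0 -lt0n; apply/card_gt0P; exists (GChar oneP).
Qed.

End AbelianCharacters.

(** * Characteristic polynomial of a matrix that is triangular in a spanning family with a dual
    family *)

Lemma sub_sum_rowP (F : fieldType) (n : nat) (I : finType) (P : pred I)
    (f : I -> 'rV[F]_n) (w : 'rV[F]_n) :
  (w <= \sum_(i | P i) <<f i>>)%MS ->
  exists c : I -> F, w = \sum_(i | P i) c i *: f i.
Proof.
case/sub_sumsmxP=> u ->.
have /fin_all_exists[c uE] i : exists a : F, u i *m <<f i>>%MS = a *: f i.
  by apply/sub_rVP; rewrite -(genmxE (f i)) submxMl.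
by exists c; apply: eq_bigr => i _.
Qed.

(* Sorting the family by rank makes the matrix of A in this basis triangular. *)
Lemma char_poly_triangular_family (F : fieldType) (n : nat) (A : 'M[F]_n)
    (I : finType) (f : I -> 'rV[F]_n) (g : I -> 'cV[F]_n) (lam : I -> F)
    (r : I -> nat) :
  (forall i j, i != j -> (f i *m g j) 0 0 = 0) ->
  (forall i, (f i *m g i) 0 0 != 0) ->
  (forall w : 'rV_n, (w <= \sum_i <<f i>>)%MS) ->
  (forall i, (f i *m A - lam i *: f i <= \sum_(j | (r j < r i)%N) <<f j>>)%MS) ->
  char_poly A = \prod_i ('X - (lam i)%:P).
Proof.
move=> fg0 fg1 fspan0 fA0.
have fspan w := sub_sum_rowP (fspan0 w).
have fA i : exists c : I -> F,
    f i *m A = lam i *: f i + \sum_(j | (r j < r i)%N) c j *: f j.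
  by have [c cE] := sub_sum_rowP (fA0 i); exists c; rewrite -cE addrC subrK.
pose s := sort (fun i j => (r i <= r j)%N) (enum I).
have s_perm : perm_eq s (enum I) by apply/permPl/perm_sort.
have s_sorted : sorted (fun i j => (r i <= r j)%N) s.
  by apply: sort_sorted => i j; apply: leq_total.
have us : uniq s by rewrite (perm_uniq s_perm) enum_uniq.
have mem_s i : i \in s by rewrite (perm_mem s_perm) mem_enum.
have -> : \prod_i ('X - (lam i)%:P) = \prod_(i <- s) ('X - (lam i)%:P).
  by rewrite (perm_big _ s_perm) big_enum.
have [i0 | I0] := pickP (mem I); last first.
  have s0 : s = [::] by case: (s) mem_s I0 => // i s' _ /(_ i).
  (* An empty family spans the zero space, which contains [const_mx 1] only in dimension 0; both
     sides are then 1. *)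
  have n0 : n = 0%N.
    apply/eqP; rewrite -leqn0 leqNgt; apply/negP=> n_gt0.
    have [c /rowP/(_ (Ordinal n_gt0))] := fspan (const_mx 1).
    rewrite mxE big_pred0 // mxE => /eqP; exact/negP/oner_neq0.
  by rewrite s0 big_nil; subst n; rewrite /char_poly det_mx00.
move=> _.
have [m sz_s] : {m | size s = m} by exists (size s).
pose e (k : 'I_m) := nth i0 s k.
have e_inj : injective e.
  by move=> k l /eqP; rewrite nth_uniq ?sz_s // => /eqP/val_inj.
have e_surj i : exists k, e k = i.
  have lt_i : (index i s < m)%N by rewrite -sz_s index_mem.
  by exists (Ordinal lt_i); rewrite /e /= nth_index.
have sum_e (G : I -> 'rV[F]_n) : \sum_i G i = \sum_k G (e k).
  rewrite -big_enum -(perm_big _ s_perm) (big_nth i0) big_mkord sz_s.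
  by [].
rewrite (big_nth i0) big_mkord sz_s -/e.
pose Fm : 'M[F]_(m, n) := \matrix_k f (e k).
pose Gm : 'M[F]_(n, m) := \matrix_(k, l) g (e l) k 0.
(* Pairing with the dual family [g] gives an invertible diagonal matrix, whence the rows of [Fm] are
   independent. *)
have FG : Fm *m Gm = diag_mx (\row_k (f (e k) *m g (e k)) 0 0).
  apply/matrixP=> k l; rewrite !mxE.
  have -> : \sum_j Fm k j * Gm j l = (f (e k) *m g (e l)) 0 0.
    by rewrite !mxE; apply: eq_bigr => j _; rewrite !mxE.
  have [<- | kl] := eqVneq k l; first by rewrite mxE.
  by rewrite fg0 // (inj_eq e_inj).
have Ffree : row_free Fm.
  have uFG : Fm *m Gm \in unitmx.
    rewrite FG unitmxE det_diag unitfE; apply/prodf_neq0 => k _.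
    by rewrite mxE.
  by apply/row_freeP; exists (Gm *m invmx (Fm *m Gm)); rewrite mulmxA mulmxV.
have Fspan w : exists c : 'rV_m, w = c *m Fm.
  have [c ->] := fspan w; exists (\row_k c (e k)).
  rewrite sum_e mulmx_sum_row; apply: eq_bigr => k _.
  by rewrite rowK mxE.
have Ffull : row_full Fm.
  rewrite -sub1mx; apply/row_subP=> k; have [c ->] := Fspan (row k 1%:M).
  exact: submxMl.
have Emn : m = n by rewrite -(eqP Ffree) (eqP Ffull).
have [c fAc] : exists c : 'I_m -> I -> F, forall k,
    f (e k) *m A = lam (e k) *: f (e k)
      + \sum_(j | (r j < r (e k))%N) c k j *: f j.
  suff /fin_all_exists [c Hc] : forall k : 'I_m, exists c : I -> F,
      f (e k) *m A = lam (e k) *: f (e k) + \sum_(j | (r j < r (e k))%N) c j *: f j.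
    by exists c.
  by move=> k; apply: fA.
(* The matrix of [A] in the basis [f (e k)]: [lam] on the diagonal, the terms of smaller [r]
   elsewhere. *)
pose L : 'M[F]_m := \matrix_(k, l)
  ((k == l)%:R * lam (e k) + (r (e l) < r (e k))%N%:R * c k (e l)).
have FA : Fm *m A = L *m Fm.
  apply/row_matrixP=> k; rewrite row_mul rowK fAc row_mul mulmx_sum_row.
  rewrite big_mkcond sum_e.
  rewrite [RHS](eq_bigr (fun l => (k == l)%:R * lam (e k) *: f (e l)
     + (if (r (e l) < r (e k))%N then c k (e l) *: f (e l) else 0))); last first.
    move=> l _; rewrite !mxE rowK scalerDl; congr (_ + _).
    by case: ifP; rewrite ?mul1r ?mul0r ?scale0r.
  rewrite big_split /= [X in _ = X + _](bigD1 k) //= eqxx mul1r.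
  rewrite [X in _ = _ + X + _]big1 ?addr0 // => l kl.
  by rewrite eq_sym (negPf kl) mul0r scale0r.
have Ltrig : is_trig_mx L.
  (* Above the diagonal, sorting gives [r (e k) <= r (e l)]; only strictly smaller ranks contribute
     to [L], so ties add no entry. *)
  apply/is_trig_mxP=> k l lt_kl; rewrite mxE -val_eqE /= ltn_eqF // mul0r add0r.
  rewrite ltnNge (_ : (r (e k) <= r (e l))%N) ?mul0r //.
  have := sorted_leq_nth _ _ i0 s_sorted; apply => //.
  - by move=> i j k'; apply: leq_trans.
  - by rewrite inE sz_s.
  - by rewrite inE sz_s.
  exact: ltnW.
transitivity (char_poly L); last first.
  rewrite char_poly_trig //; apply: eq_bigr => k _.
  by rewrite mxE eqxx ltnn mul1r mul0r addr0.
clearbody L Fm; clear -Emn Ffree FA; subst n.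
have uF : Fm \in unitmx by rewrite -row_free_unit.
have mxpF : map_mx polyC Fm \in unitmx.
  by rewrite unitmxE det_map_mx rmorph_unit // -unitmxE.
rewrite /char_poly.
(* [Fm] is now square, invertible, and intertwines [A] with [L]; its determinant cancels. *)
have E : map_mx polyC Fm *m char_poly_mx A = char_poly_mx L *m map_mx polyC Fm.
  rewrite /char_poly_mx mulmxBr mulmxBl -!map_mxM FA; congr (_ - _).
  by rewrite scalar_mxC.
move/(congr1 determinant): E; rewrite !det_mulmx mulrC; apply: mulIr.
by rewrite -unitmxE.
Qed.

(** * Lifting of units, cyclic modules and their annihilators *)

Lemma idempotent_power (S : finComPzRingType) (a : S) :
  exists2 N, (0 < N)%N & a ^+ N * a ^+ N = a ^+ N.
Proof.
(* Pigeonhole on the powers of [a]: they are periodic with period [p = j - i] from exponent [i]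
   on. *)
have /injectivePn[i [j]] : ~~ injectiveb (fun k : 'I_#|S|.+1 => a ^+ k).
  apply/negP=> /injectiveP/leq_card; rewrite card_ord.
  by rewrite [X in (_ <= X)%N -> _](_ : _ = #|S|) // ltnn.
wlog lt_ij : i j / (i < j)%N.
  move=> IH neq_ij eq_ij; have := neq_ij; rewrite neq_ltn => /orP[] lt_ij.
    exact: IH lt_ij neq_ij eq_ij.
  by apply: (IH j i lt_ij); rewrite 1?eq_sym.
move=> _ eq_ij; pose p := (j - i)%N.
have p_gt0 : (0 < p)%N by rewrite subn_gt0.
have per m k : (i <= m)%N -> a ^+ (m + k * p) = a ^+ m.
  move=> le_im; elim: k => [|k IHk]; first by rewrite addn0.
  rewrite mulSn addnCA addnC addnBA ?(ltnW lt_ij) // -addnBAC; last first.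
    by rewrite (leq_trans le_im) ?leq_addr.
  by rewrite exprD -eq_ij -exprD subnK // (leq_trans le_im) ?leq_addr.
(* The exponent has to be a multiple of [p] and at least [i]; the successor keeps it positive when
   [i = 0]. *)
exists (i.+1 * p)%N; first by rewrite muln_gt0.
by rewrite -exprD per // (leq_trans (leqnSn i)) // leq_pmulr.
Qed.

Section UnitsAndAnnihilators.
Variables (R : finComPzRingType) (M : finModType R).
Implicit Types (W : {set M}) (x y : M) (u v : unit_group R).

Lemma unit_group_commute u v : commute u v.
Proof. by apply: val_inj; rewrite /= mulrC. Qed.

(* If e = a ^+ N is idempotent then a * e + (1 - e) is a unit, and e is
   congruent to 1 because a is invertible modulo ann W. *)
Lemma unit_lifting W (a b : R) : a * b - 1 \in ann W ->
  exists u, val u - a \in ann W.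
Proof.
move=> ab1; have [N N_gt0 ee] := idempotent_power a; set e := a ^+ N in ee.
have e1 : 1 - e \in ann W.
  (* As [(1 - e) * e = 0], the product collapses to [1 - e], while [e * b ^+ N - 1] is a multiple of
     [a * b - 1]. *)
  have -> : 1 - e = - (1 - e) * (e * b ^+ N - 1).
    rewrite mulrBr mulr1 opprK mulrA mulNr mulrBl mul1r ee subrr oppr0 mul0r.
    by rewrite add0r.
  by rewrite ann_mull // /e -exprMn subrX1 mulrC ann_mull.
have Uu : is_unit (a * e + (1 - e)).
  have e1e : e * (1 - e) = 0 by rewrite mulrBr mulr1 ee subrr.
  have mulE (c f : R) : (a * e + f) * (c * e + f)
      = a * c * (e * e) + a * (e * f) + (c * (e * f) + f * f).
    by rewrite mulrDl !mulrDr (mulrACA a) [f * (_ * e)]mulrC !mulrA.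
  (* On the component of [e], [a ^+ N.-1] inverts [a] because [a ^+ N = e]; on that of [1 - e] both
     factors are 1. *)
  apply/existsP; exists (a ^+ N.-1 * e + (1 - e)); apply/eqP.
  rewrite mulE ee e1e -exprS prednK // ee !mulr0 addr0 add0r.
  by rewrite mulrBl mul1r e1e subr0 addrC subrK.
exists (Sub (a * e + (1 - e)) Uu) => /=.
have -> : a * e + (1 - e) - a = (1 - a) * (1 - e).
  by rewrite [RHS]mulrBl mul1r mulrBr mulr1 opprB [RHS]addrA [a * e + _]addrC.
exact: ann_mull.
Qed.

Definition cyc x : {set M} := [set r *: x | r : R].

Lemma cyc_id x : x \in cyc x.
Proof. by apply/imsetP; exists 1; rewrite ?scale1r. Qed.

Lemma cyc_mem x (r : R) : r *: x \in cyc x.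
Proof. exact: imset_f. Qed.

Lemma cyc_submodule x : cyc x \in cyclic_submodules M.
Proof. exact: imset_f. Qed.

Lemma cyc_sub x (r : R) : cyc (r *: x) \subset cyc x.
Proof. by apply/subsetP=> _ /imsetP[s _ ->]; rewrite scalerA cyc_mem. Qed.

Lemma ann_cyc x (r : R) : (r \in ann (cyc x)) = (r *: x == 0).
Proof.
apply/forall_inP/eqP=> [/(_ x (cyc_id x))/eqP // | rx0 _ /imsetP[s _ ->]].
by rewrite scalerA mulrC -scalerA rx0 scaler0.
Qed.

Lemma ann_cycB x (r s : R) : (r - s \in ann (cyc x)) = (r *: x == s *: x).
Proof. by rewrite ann_cyc scalerBl subr_eq0. Qed.

Lemma scale_unitK u : cancel (fun x => val u *: x) (fun x => val u^-1%g *: x).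
Proof. by move=> x; rewrite scalerA -[_ * _]/(val (u^-1 * u)%g) mulVg scale1r. Qed.

Lemma cyc_unit x u : cyc (val u *: x) = cyc x.
Proof.
apply/eqP; rewrite eqEsubset cyc_sub /=.
by rewrite -{1}(scale_unitK u x) cyc_sub.
Qed.

(** If [y = a *: x] and [x = b *: y], then [a * b] is 1 modulo the annihilator of [x], and [a] can
    be replaced by a unit. *)
Lemma cyc_eqP x y : cyc x = cyc y -> exists u, y = val u *: x.
Proof.
move=> eq_xy.
have /imsetP[a _ ya] : y \in cyc x by rewrite eq_xy cyc_id.
have /imsetP[b _ xb] : x \in cyc y by rewrite -eq_xy cyc_id.
have [|u] := @unit_lifting (cyc x) a b.
  by rewrite ann_cycB scale1r mulrC -scalerA -ya -xb.
by rewrite ann_cycB -ya => /eqP <-; exists u.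
Qed.

Lemma units_plus_ann_cycP x (a : R) :
  reflect (exists u, a *: x = val u *: x) (a \in units_plus_ann (cyc x)).
Proof.
apply: (iffP imset2P) => [[u z _ zW ->] | [u au]].
  by exists u; rewrite scalerDl; move: zW; rewrite ann_cyc => /eqP->; rewrite addr0.
exists u (a - val u); first by rewrite inE.
  by rewrite ann_cycB au.
by rewrite addrC subrK.
Qed.

(** Membership guarantees that [pick] succeeds, and congruence modulo the annihilator means equal
    action on [x]. *)
Lemma unit_liftP x (a : R) : a \in units_plus_ann (cyc x) ->
  val (unit_lift (cyc x) a) *: x = a *: x.
Proof.
move/units_plus_ann_cycP=> [u au]; rewrite /unit_lift; case: pickP => [v | no_u].
  by move/eqP/to_quotP; rewrite ann_cycB => /eqP.
by have /eqP[] := no_u u; apply/to_quotP; rewrite ann_cycB au.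
Qed.

(** Otherwise [a *: x] would generate [cyc x] and be a unit multiple of [x]. This strict drop makes
    the walk triangular. *)
Lemma cyc_card_lt x (a : R) : a \notin units_plus_ann (cyc x) ->
  (#|cyc (a *: x)| < #|cyc x|)%N.
Proof.
move=> aW; apply: proper_card; rewrite properEneq cyc_sub andbT.
apply: contra aW => /eqP/esym/cyc_eqP[u au].
by apply/units_plus_ann_cycP; exists u.
Qed.

(** Unit lifting makes [unit_proj] surjective, so factoring through it amounts to being trivial on
    its kernel. *)
Lemma factors_throughP (C : numClosedFieldType) W (rho : gchar C (unit_group R)) :
  reflect (forall u, val u - 1 \in ann W -> rho u = 1) (factors_through W rho).
Proof.
apply: (iffP existsP) => [[rho' /forallP rhoE] u uW | rho1].
  rewrite (eqP (rhoE u)) (_ : unit_proj W u = 1%g) ?gchar1 //.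
  by apply: val_inj; apply/to_quotP.
have lift (q : unit_group (ann_quot W)) : exists u, unit_proj W u == q.
  have /existsP[y /eqP qy] := valP q.
  have [|u uW] := @unit_lifting W (generic_quotient.repr (val q))
                     (generic_quotient.repr y).
    by apply/to_quotP; rewrite to_quotM !to_quotK.
  by exists u; apply/eqP/val_inj; rewrite /= -[RHS]to_quotK; apply/to_quotP.
(* A set-theoretic section of [unit_proj]; as [rho] is constant on the fibres, [rho (l q)] is still
   multiplicative in [q]. *)
pose l q := xchoose (lift q).
have lK q : unit_proj W (l q) = q by apply/eqP/(xchooseP (lift q)).
have rho_eq u v : unit_proj W u = unit_proj W v -> rho u = rho v.
  move=> /(congr1 val)/= /to_quotP uv; apply/eqP.
  rewrite -(inj_eq (mulfI (gchar_neq0 rho v^-1%g))) -!gcharM mulVg gchar1.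
  apply/eqP/rho1; rewrite -[1]/(val (1%g : unit_group R)) -(mulVg v) /= -mulrBr.
  exact: ann_mull.
have rhoP : is_gchar [ffun q => rho (l q)].
  apply/andP; split.
    by rewrite ffunE -(gchar1 rho); apply/eqP/rho_eq; rewrite lK; apply: val_inj.
  apply/forallP=> q; apply/forallP=> q'; rewrite !ffunE -gcharM.
  apply/eqP/rho_eq; rewrite lK; apply: val_inj => /=.
  by rewrite to_quotM -{1}(lK q) -{1}(lK q').
exists (GChar rhoP); apply/forallP=> u; rewrite /= ffunE; apply/eqP/rho_eq.
by rewrite lK.
Qed.

(** A cyclic module is [R] modulo its annihilator: equal annihilators make [r *: x |-> r *: y] well
    defined and injective. *)
Lemma module_iso_cycP x y :
  reflect (ann (cyc x) =i ann (cyc y)) (module_iso (cyc x) (cyc y)).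
Proof.
apply: (iffP existsP) => [[f /and4P[/eqP fW /dinjectiveP f_inj _ fZ]] r | annE].
  have fM s : f (s *: x) = s *: f x.
    by have /forallP/(_ s)/forall_inP/(_ x (cyc_id x))/eqP := fZ.
  have fE : cyc y = cyc (f x).
    rewrite -fW; apply/setP=> z.
    apply/imsetP/imsetP=> [[_ /imsetP[s _ ->] ->] | [s _ ->]].
      by exists s; rewrite ?fM.
    by exists (s *: x); rewrite ?cyc_mem ?fM.
  have f0 : f 0 = 0 by rewrite -(scale0r x) fM !scale0r.
  rewrite fE !ann_cyc -fM; apply/eqP/eqP=> [-> // | frx].
  move: (etrans frx (esym f0)).
  apply: f_inj; first exact: cyc_mem.
  by rewrite -(scale0r x); apply: cyc_mem.
(* Any coefficient [r] will do, by equality of the annihilators; the default 0 is reached only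
   outside [cyc x]. *)
pose f := [ffun z => odflt 0 [pick r : R | r *: x == z] *: y].
have fE r : f (r *: x) = r *: y.
  rewrite ffunE; case: pickP => [s /= | /(_ r)]; last by rewrite eqxx.
  by rewrite -ann_cycB annE ann_cycB => /eqP.
exists f; apply/and4P; split.
- apply/eqP/setP=> z; apply/imsetP/imsetP=> [[_ /imsetP[s _ ->] ->] | [s _ ->]].
    by exists s; rewrite ?fE.
  by exists (s *: x); rewrite ?cyc_mem ?fE.
- apply/dinjectiveP=> _ _ /imsetP[r _ ->] /imsetP[s _ ->]; rewrite !fE => /eqP.
  by rewrite -ann_cycB -annE ann_cycB => /eqP.
- apply/forall_inP=> _ /imsetP[r _ ->]; apply/forall_inP=> _ /imsetP[s _ ->].
  by rewrite -scalerDl !fE scalerDl.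
- apply/forallP=> s; apply/forall_inP=> _ /imsetP[r _ ->].
  by rewrite scalerA !fE scalerA.
Qed.

End UnitsAndAnnihilators.

(** * Fourier analysis on V and orbit sums of characters under the units *)

Section OrbitSums.
Variables (C : numClosedFieldType) (R : finComPzRingType) (V : finModType R).
Implicit Types (chi psi : dual C V) (rho sigma : gchar C (unit_group R)).
Implicit Types (u v : unit_group R).

Definition dual_eval chi (x : V) : C := (chi : gchar C (V : finZmodType)) x.

Lemma dual_evalZ (r : R) chi x : dual_eval (r *: chi) x = dual_eval chi (r *: x).
Proof. exact: ffunE. Qed.

Lemma dual_evalD chi x y :
  dual_eval chi (x + y) = dual_eval chi x * dual_eval chi y.
Proof. exact: (gcharM (chi : gchar C (V : finZmodType))). Qed.

Lemma dual_eval_neq0 chi x : dual_eval chi x != 0.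
Proof. exact: gchar_neq0. Qed.

Lemma dual_eval0 x : dual_eval 0 x = 1.
Proof. exact: ffunE. Qed.

Lemma dual_evalB chi x y :
  dual_eval chi (x - y) = dual_eval chi x * (dual_eval chi y)^-1.
Proof.
apply: (canRL (mulfK (dual_eval_neq0 chi y))).
by rewrite -dual_evalD subrK.
Qed.

Lemma dual_orthogonality chi psi :
  \sum_x dual_eval chi x * (dual_eval psi x)^-1 = (chi == psi)%:R * #|{: V}|%:R.
Proof.
have [-> | /eqP neq] := eqVneq.
  rewrite (eq_bigr (fun=> 1)) ?sumr_const ?mul1r // => x _.
  by rewrite mulfV ?dual_eval_neq0.
by rewrite mul0r; apply: (@gchar_orthogonality C (V : finZmodType) chi psi).
Qed.

Lemma dual_sum chi : \sum_x dual_eval chi x = (chi == 0)%:R * #|{: V}|%:R.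
Proof.
rewrite -dual_orthogonality; apply: eq_bigr => x _.
by rewrite dual_eval0 invr1 mulr1.
Qed.

Lemma dual_completeness x y :
  \sum_(chi : dual C V) dual_eval chi x * (dual_eval chi y)^-1
    = (x == y)%:R * #|{: dual C V}|%:R.
Proof.
under eq_bigr do rewrite -dual_evalB.
rewrite -subr_eq0; apply: (@gchar_sum_characters C (V : finZmodType)).
by move=> y' z'; apply: addrC.
Qed.

Definition char_row chi : 'rV[C]_#|{: V}| := \row_i dual_eval chi (enum_val i).

(** Character values are roots of unity, so the inverses are complex conjugates and pairing with
    [char_row] is the Hermitian product. *)
Definition char_col chi : 'cV[C]_#|{: V}| := \col_i (dual_eval chi (enum_val i))^-1.

Lemma char_row_col chi psi :
  (char_row chi *m char_col psi) 0 0 = (chi == psi)%:R * #|{: V}|%:R.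
Proof.
rewrite -dual_orthogonality mxE [RHS](reindex_onto enum_val enum_rank) /=.
  by apply: eq_big => [i | i _]; rewrite ?enum_valK ?eqxx // !mxE.
by move=> x _; rewrite enum_rankK.
Qed.

(** Up to the factor [#|unit_group R|], the projection of [char_row chi] to the [rho]-isotypic part
    for the action of the units. *)
Definition orbit_sum rho chi : 'rV[C]_#|{: V}| :=
  \sum_u (rho u)^-1 *: char_row (val u *: chi).

(** The dual family that detects linear independence of the orbit sums. *)
Definition orbit_cosum rho chi : 'cV[C]_#|{: V}| :=
  \sum_u rho u *: char_col (val u *: chi).

Lemma orbit_sum_unit rho v chi :
  orbit_sum rho (val v *: chi) = rho v *: orbit_sum rho chi.
Proof.
rewrite /orbit_sum scaler_sumr [RHS](reindex_inj (mulIg v)) /=.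
apply: eq_bigr => u _; rewrite !scalerA gcharM invfM mulrCA mulfV ?gchar_neq0 //.
by rewrite mulr1.
Qed.

(** Some unit [u] fixes [chi] although [rho u != 1], so the orbit sum equals [rho u] times
    itself. *)
Lemma orbit_sum_eq0 rho chi :
  ~~ factors_through (cyc chi) rho -> orbit_sum rho chi = 0.
Proof.
move/factors_throughP => nfact.
have /existsP[u /andP[]] :
    [exists u : unit_group R, (val u *: chi == chi) && (rho u != 1)].
  apply: contra_notT nfact; rewrite negb_exists => /forallP no_u u.
  rewrite ann_cycB scale1r => uchi; apply/eqP; have := no_u u.
  by rewrite uchi negbK.
move=> /eqP uchi rhou.
have /eqP : orbit_sum rho chi = rho u *: orbit_sum rho chi.
  by rewrite -orbit_sum_unit uchi.
rewrite -subr_eq0 -[X in X - _]scale1r -scalerBl scaler_eq0 subr_eq0 eq_sym.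
by rewrite (negPf rhou) => /eqP.
Qed.

Lemma orbit_sum_char_col rho chi psi :
  (orbit_sum rho chi *m char_col psi) 0 0
    = \sum_u (rho u)^-1 * ((val u *: chi == psi)%:R * #|{: V}|%:R).
Proof.
rewrite mulmx_suml summxE; apply: eq_bigr => u _.
by rewrite -scalemxAl mxE char_row_col.
Qed.

(** Unit multiples of [chi] and [psi] generate different submodules, so they never coincide. *)
Lemma orbit_sum_cosum_neq rho sigma chi psi : cyc chi != cyc psi ->
  (orbit_sum rho chi *m orbit_cosum sigma psi) 0 0 = 0.
Proof.
move=> neq; rewrite mulmx_sumr summxE big1 // => v _.
rewrite -scalemxAr mxE orbit_sum_char_col big1 ?mulr0 // => u _.
have [eq_uv | _] := eqVneq; last by rewrite mul0r mulr0.
by move: neq; rewrite -(cyc_unit chi u) eq_uv cyc_unit eqxx.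
Qed.

(** For each [v], the surviving terms come from [v] times the stabilizer of [chi], on which [rho] is
    trivial. *)
Lemma orbit_sum_cosum rho sigma chi : factors_through (cyc chi) rho ->
  (orbit_sum rho chi *m orbit_cosum sigma chi) 0 0
    = (\sum_v sigma v * (rho v)^-1)
      * (#|[set u : unit_group R | val u *: chi == chi]|%:R * #|{: V}|%:R).
Proof.
move/factors_throughP=> rho1.
rewrite mulmx_sumr summxE mulr_suml; apply: eq_bigr => v _.
rewrite -scalemxAr mxE orbit_sum_char_col (reindex_inj (mulgI v)) /= -mulrA.
congr (_ * _).
have -> : #|[set u : unit_group R | val u *: chi == chi]|%:R
    = \sum_u (val (u : unit_group R) *: chi == chi)%:R :> C.
  rewrite -sum1_card natr_sum big_mkcond; apply: eq_bigr => u _.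
  by rewrite inE; case: eqP.
rewrite mulr_suml mulr_sumr; apply: eq_bigr => u _.
rewrite -scalerA (can_eq (scale_unitK v)).
case: eqP => [uchi | _]; last by rewrite !mul0r !mulr0.
by rewrite gcharM (rho1 u) ?mulr1 // ann_cycB scale1r uchi.
Qed.

(** Fourier inversion on the unit group: the sum over [rho] isolates [u = 1]. *)
Lemma sum_orbit_sum chi :
  \sum_rho orbit_sum rho chi = #|{: gchar C (unit_group R)}|%:R *: char_row chi.
Proof.
rewrite exchange_big /= (bigD1 1%g) //=.
have E u : \sum_(rho : gchar C (unit_group R)) (rho u)^-1 *: char_row (val u *: chi)
    = ((u == 1%g)%:R * #|{: gchar C (unit_group R)}|%:R) *: char_row (val u *: chi).
  rewrite -scaler_suml; congr (_ *: _).
  rewrite -eq_invg1 -gchar_sum_characters; last exact: unit_group_commute.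
  by apply: eq_bigr => rho _; rewrite gcharV.
rewrite E eqxx mul1r scale1r big1 ?addr0 // => u u1.
by rewrite E (negPf u1) mul0r scale0r.
Qed.

(** Fourier inversion on V, with [d chi] the coefficients of [w], shows that the characters span all
    functions. *)
Lemma char_row_span (w : 'rV[C]_#|{: V}|) (m : nat) (B : 'M[C]_(m, #|{: V}|)) :
  (forall chi, (char_row chi <= B)%MS) -> (w <= B)%MS.
Proof.
move=> sB.
pose d chi := \sum_i w 0 i * (dual_eval chi (enum_val i))^-1.
have N0 : #|{: dual C V}|%:R != 0 :> C.
  exact: (@card_gchar_neq0 C (V : finZmodType)).
have -> : w = #|{: dual C V}|%:R^-1 *: \sum_(chi : dual C V) d chi *: char_row chi.
  apply/rowP=> j; rewrite mxE summxE.
  have -> : \sum_(chi : dual C V) (d chi *: char_row chi) 0 j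
      = \sum_i w 0 i * ((j == i)%:R * #|{: dual C V}|%:R).
    under eq_bigr do rewrite !mxE mulr_suml.
    rewrite exchange_big; apply: eq_bigr => i _.
    rewrite -(inj_eq enum_val_inj) -dual_completeness mulr_sumr.
    by apply: eq_bigr => chi _; rewrite -mulrA [_^-1 * _]mulrC.
  rewrite (bigD1 j) //= eqxx mul1r big1 ?addr0 => [|i neq_ij].
    by rewrite mulrCA mulVf ?mulr1.
  by rewrite eq_sym (negPf neq_ij) mul0r mulr0.
by apply/scalemx_sub/summx_sub => chi _; apply/scalemx_sub.
Qed.

Definition cyc_gen (W : {set dual C V}) : dual C V :=
  odflt 0 [pick chi | W == cyc chi].

Lemma cyc_genK W : W \in cyclic_submodules (dual C V) -> cyc (cyc_gen W) = W.
Proof.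
case/imsetP=> chi _ ->; rewrite /cyc_gen; case: pickP => [psi /eqP // | ].
by move/(_ chi); rewrite eqxx.
Qed.

Lemma orbit_sum_cyc_gen rho chi : exists a : C,
  orbit_sum rho chi = a *: orbit_sum rho (cyc_gen (cyc chi)).
Proof.
have [u {1}->] := cyc_eqP (cyc_genK (cyc_submodule chi)).
by exists (rho u); rewrite orbit_sum_unit.
Qed.

End OrbitSums.

(** * The walk with complex weights, in the basis of orbit sums *)

Lemma char_poly_tr (F : fieldType) (n : nat) (A : 'M[F]_n) :
  char_poly A^T = char_poly A.
Proof.
rewrite /char_poly -det_tr; congr (\det _); apply/matrixP=> i j.
by rewrite !mxE eq_sym.
Qed.

(** Both sides integrate [g] against the image under [h] of the weights [p]; this removes the fibre
    sums in the step kernel. *)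
Lemma sum_fibers (F : comPzSemiRingType) (I J : finType) (h : I -> J)
    (p : I -> F) (g : J -> F) :
  \sum_y g y * (\sum_(i | h i == y) p i) = \sum_i p i * g (h i).
Proof.
rewrite [RHS](partition_big h xpredT) //=; apply: eq_bigr => y _.
by rewrite mulr_sumr; apply: eq_bigr => i /eqP <-; rewrite mulrC.
Qed.

Section ComplexWalk.
Variables (C : numClosedFieldType) (R : finComPzRingType) (V : finModType R).
Variables (q : R -> C) (al : C).
Hypothesis q_sum : \sum_a q a = 1.
Implicit Types (chi psi : dual C V) (rho sigma : gchar C (unit_group R)).

Definition complex_step (x y : V) : C :=
  al * (\sum_(b : V | x + b == y) #|{: V}|%:R^-1)
  + (1 - al) * (\sum_(a : R | a *: x == y) q a).

Definition complex_walk_mx : 'M[C]_#|{: V}| :=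
  \matrix_(i, j) complex_step (enum_val i) (enum_val j).

Definition complex_lambda (W : {set dual C V}) rho : C :=
  if W == [set 0] then 1
  else (1 - al) * \sum_(a in units_plus_ann W) q a * rho (unit_lift W a).

(** A uniform translation multiplies [chi] by its mean over V, which is 0 unless [chi] is trivial;
    multiplication by [a] turns [chi] into [a *: chi]. *)
Lemma char_row_walk chi :
  char_row chi *m complex_walk_mx^T
    = (al * (chi == 0)%:R) *: char_row chi
      + (1 - al) *: \sum_a q a *: char_row (a *: chi).
Proof.
apply/rowP=> i; rewrite !mxE summxE; set x := enum_val i.
have -> : \sum_j char_row chi 0 j * complex_walk_mx^T j i
    = \sum_(y : V) dual_eval chi y * complex_step x y.
  rewrite [RHS](reindex_onto enum_val enum_rank) /=; last first.
    by move=> y _; rewrite enum_rankK.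
  by apply: eq_big => [j | j _]; rewrite ?enum_valK ?eqxx // !mxE.
under eq_bigr => y _ do rewrite mulrDr (mulrCA _ al) (mulrCA _ (1 - al)).
rewrite big_split /= -!mulr_sumr !sum_fibers; congr (_ + _ * _); last first.
  by apply: eq_bigr => a _; rewrite !mxE dual_evalZ.
rewrite -mulrA; congr (_ * _).
under eq_bigr => b _ do rewrite dual_evalD mulrCA.
rewrite -mulr_sumr -mulr_sumr dual_sum mulrC mulrCA.
rewrite mulVf ?mulr1 // pnatr_eq0 -lt0n.
by apply/card_gt0P; exists 0.
Qed.

Lemma orbit_sum_walk rho chi :
  orbit_sum rho chi *m complex_walk_mx^T
    = (al * (chi == 0)%:R) *: orbit_sum rho chi
      + (1 - al) *: \sum_a q a *: orbit_sum rho (a *: chi).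
Proof.
rewrite /orbit_sum mulmx_suml.
under eq_bigr => u _ do rewrite -scalemxAl char_row_walk scalerDr.
rewrite big_split /=; congr (_ + _).
  rewrite scaler_sumr; apply: eq_bigr => u _; rewrite !scalerA mulrC.
  by rewrite -(can_eq (scale_unitK u) chi 0) scaler0.
rewrite scaler_sumr.
under eq_bigr => u _ do rewrite scalerA mulrC -scalerA.
rewrite -scaler_sumr -scaler_sumr; congr (_ *: _).
under eq_bigr => u _ do rewrite scaler_sumr.
rewrite exchange_big; apply: eq_bigr => a _; rewrite scaler_sumr.
by apply: eq_bigr => u _; rewrite !scalerA mulrC [a * _]mulrC.
Qed.

Lemma cyc_eq_set0 chi : (cyc chi == [set 0]) = (chi == 0).
Proof.
apply/eqP/eqP=> [chi0 | ->].
  by apply/set1P; rewrite -chi0 cyc_id.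
apply/setP=> psi; rewrite inE; apply/imsetP/eqP=> [[r _ ->] | ->].
  by rewrite scaler0.
by exists 0; rewrite ?scaler0.
Qed.

(** For [a] in [units_plus_ann], [a *: chi] is [chi] moved by [unit_lift], so these terms add up to
    [complex_lambda]. For [chi = 0] the factor is [al + (1 - al) = 1]. *)
Lemma orbit_sum_walk_lambda rho chi :
  orbit_sum rho chi *m complex_walk_mx^T
      - complex_lambda (cyc chi) rho *: orbit_sum rho chi
    = if chi == 0 then 0 else
      (1 - al) *: \sum_(a | a \notin units_plus_ann (cyc chi))
        q a *: orbit_sum rho (a *: chi).
Proof.
rewrite orbit_sum_walk /complex_lambda cyc_eq_set0; case: eqP => [-> | _].
  under eq_bigr => a _ do rewrite scaler0.
  rewrite -scaler_suml scalerA -scalerDl -scalerBl q_sum.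
  by rewrite !mulr1 [al + _]addrC subrK subrr scale0r.
rewrite mulr0 scale0r add0r (bigID (mem (units_plus_ann (cyc chi)))) /=.
rewrite scalerDr addrAC -scalerA -scalerBr scaler_suml -sumrB big1 ?scaler0 ?add0r //.
by move=> a aU; rewrite -(unit_liftP aU) orbit_sum_unit scalerA subrr.
Qed.

Definition index_pred : {pred {set dual C V} * gchar C (unit_group R)} :=
  [pred p | (p.1 \in cyclic_submodules (dual C V)) && factors_through p.1 p.2].

Lemma char_poly_complex_walk :
  char_poly complex_walk_mx
    = \prod_(W in cyclic_submodules (dual C V))
        \prod_(rho | factors_through W rho) ('X - (complex_lambda W rho)%:P).
Proof.
(* Row vectors are functions on V, on which the walk acts through the transpose. *)
rewrite -char_poly_tr pair_big_dep /= [RHS](big_sub index_pred).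
pose f (i : {p in index_pred}) := orbit_sum (val i).2 (cyc_gen (val i).1).
pose g (i : {p in index_pred}) := orbit_cosum (val i).2 (cyc_gen (val i).1).
have cycW (i : {p in index_pred}) : cyc (cyc_gen (val i).1) = (val i).1.
  by case/andP: (valP i) => Wi _; apply: cyc_genK.
have factW (i : {p in index_pred}) :
    factors_through (cyc (cyc_gen (val i).1)) (val i).2.
  by rewrite cycW; case/andP: (valP i).
have orbitP rho chi : orbit_sum rho chi = 0 \/
    exists i, [/\ (val (i : {p in index_pred})).1 = cyc chi
                & (orbit_sum rho chi <= <<f i>>)%MS].
  have [fact | /orbit_sum_eq0 ->] := boolP (factors_through (cyc chi) rho);
    last by left.
  have Pi : (cyc chi, rho) \in index_pred by rewrite inE /= cyc_submodule.
  right; exists (exist (fun p => p \in index_pred) _ Pi); split=> //.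
  rewrite genmxE /f /=; have [a ->] := orbit_sum_cyc_gen rho chi.
  exact: scalemx_sub.
(* The rank is the order of the submodule. *)
apply: (@char_poly_triangular_family _ _ _ _ f g _ (fun i => #|(val i).1|)).
- move=> i j neq_ij; rewrite /f /g.
  have [eqW | neqW] := eqVneq (val i).1 (val j).1; last first.
    by apply: orbit_sum_cosum_neq; rewrite !cycW.
  rewrite -eqW orbit_sum_cosum // gchar_orthogonality ?mul0r // => eq_rho.
  case/eqP: neq_ij; apply: val_inj.
  by rewrite [LHS]surjective_pairing eqW -eq_rho -surjective_pairing.
- move=> i; rewrite /f /g orbit_sum_cosum //.
  rewrite (eq_bigr (fun=> 1)) => [|u _]; last by rewrite mulfV ?gchar_neq0.
  rewrite sumr_const -!natrM pnatr_eq0 -lt0n !muln_gt0; apply/and3P; split.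
  + by apply/card_gt0P; exists 1%g.
  + by apply/card_gt0P; exists 1%g; rewrite inE scale1r.
  + by apply/card_gt0P; exists 0.
(* Spanning combines the inversions on V and on the unit group; each orbit sum is 0 or a multiple of
   a basis vector. *)
- move=> w; apply: char_row_span => chi.
  have -> : char_row chi = #|{: gchar C (unit_group R)}|%:R^-1
                             *: \sum_rho orbit_sum rho chi.
    by rewrite sum_orbit_sum scalerA mulVf ?scale1r // card_gchar_neq0.
  apply/scalemx_sub/summx_sub => rho _.
  have [-> | [i [_ sub_i]]] := orbitP rho chi; first exact: sub0mx.
  exact: (sumsmx_sup i).
- move=> i; rewrite /f -{2}(cycW i) orbit_sum_walk_lambda.
  case: eqP => _; first exact: sub0mx.
  apply/scalemx_sub/summx_sub => a aU; apply: scalemx_sub.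
  have [-> | [j [jW sub_j]]] := orbitP (val i).2 (a *: cyc_gen (val i).1).
    exact: sub0mx.
  apply: (sumsmx_sup j) => //.
  by rewrite jW -[X in (_ < #|pred_of_set X|)%N](cycW i) cyc_card_lt.
Qed.

End ComplexWalk.

(** * Return to real weights and grouping by isomorphism classes *)

Section Walk.
Local Open Scope complex_scope.
Variables (K : realType) (R : finComPzRingType) (V : finModType R).
Variables (Q : R -> K) (alpha : K).
Local Notation C := K[i].
Implicit Types (chi psi : dual C V) (rho sigma : gchar C (unit_group R)).

Lemma lambdaE (W : {set dual C V}) rho :
  lambda Q alpha W rho = complex_lambda (fun a => (Q a)%:C) alpha%:C W rho.
Proof. by rewrite /lambda /complex_lambda rmorphB rmorph1. Qed.

Lemma map_transition_matrix :
  map_mx (real_complex K)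
      (transition_matrix (coin_toss_step (@uniform K V) Q alpha))
    = complex_walk_mx V (fun a => (Q a)%:C) alpha%:C.
Proof.
apply/matrixP=> i j; rewrite !mxE /coin_toss_step /complex_step.
rewrite rmorphD !rmorphM !rmorph_sum rmorphB rmorph1; congr (_ * _ + _).
by apply: eq_bigr => b _; rewrite fmorphV rmorph_nat.
Qed.

Lemma char_poly_walk : \sum_a Q a = 1 ->
  char_poly (map_mx (real_complex K)
               (transition_matrix (coin_toss_step (@uniform K V) Q alpha)))
    = \prod_(W in cyclic_submodules (dual C V))
        \prod_(rho | factors_through W rho) ('X - (lambda Q alpha W rho)%:P).
Proof.
move=> Q_sum; rewrite map_transition_matrix char_poly_complex_walk.
  by apply: eq_bigr => W _; apply: eq_bigr => rho _; rewrite lambdaE.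
by rewrite -rmorph_sum Q_sum rmorph1.
Qed.

Lemma eq_ann_factors (W1 W2 : {set dual C V}) rho :
  ann W1 =i ann W2 -> factors_through W1 rho = factors_through W2 rho.
Proof.
move=> annE; apply/factors_throughP/factors_throughP => rho1 u uW; apply: rho1.
  by rewrite annE.
by rewrite -annE.
Qed.

(** Every ingredient sees the submodule through its annihilator only; being zero means being
    annihilated by 1. *)
Lemma eq_ann_lambda chi psi rho : ann (cyc chi) =i ann (cyc psi) ->
  lambda Q alpha (cyc chi) rho = lambda Q alpha (cyc psi) rho.
Proof.
move=> annE; rewrite /lambda !cyc_eq_set0.
have -> : (chi == 0) = (psi == 0).
  by have := annE 1; rewrite !ann_cyc !scale1r.
have -> : units_plus_ann (cyc chi) = units_plus_ann (cyc psi).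
  apply/setP=> a; apply/imset2P/imset2P=> -[u z uU zW ->].
    by exists u z => //; rewrite -[z \in _]annE.
  by exists u z => //; rewrite [z \in _]annE.
case: ifP => // _; congr (_ * _); apply: eq_bigr => a _; congr (_ * rho _).
rewrite /unit_lift; congr (odflt _ _); apply: eq_pick => u.
by apply/eqP/eqP => /to_quotP uaW; apply/to_quotP; rewrite ?annE // -annE.
Qed.

Lemma module_iso_equivalence :
  {in cyclic_submodules (dual C V) & &, equivalence_rel (@module_iso R (dual C V))}.
Proof.
move=> _ _ _ /imsetP[x _ ->] /imsetP[y _ ->] /imsetP[z _ ->]; split.
  exact/module_iso_cycP.
move/module_iso_cycP=> xy; apply/module_iso_cycP/module_iso_cycP => [xz | yz] r.
  by rewrite -xy xz.
by rewrite xy yz.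
Qed.

Lemma predicted_product (rep : {set {set dual C V}} -> {set dual C V}) :
  (forall c, c \in iso_classes (dual C V) -> rep c \in c) ->
  \prod_(x <- predicted_eigenvalues Q alpha rep) ('X - x%:P)
    = \prod_(W in cyclic_submodules (dual C V))
        \prod_(rho | factors_through W rho) ('X - (lambda Q alpha W rho)%:P).
Proof.
move=> repP; have partP := equivalence_partitionP module_iso_equivalence.
rewrite [RHS](set_partition_big _ partP) big_flatten big_allpairs_dep big_enum /=.
apply: eq_bigr => c c_iso; have rep_c := repP c c_iso.
have [_ tiP _] := and3P partP.
have cyc_c W : W \in c -> W \in cyclic_submodules (dual C V).
  by move=> Wc; rewrite -(cover_partition partP); apply/bigcupP; exists c.
(* The set counted by the multiplicity is the class [c] itself. *)
have cE : [set W in cyclic_submodules (dual C V) | module_iso (rep c) W] = c.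
  apply/setP=> W; rewrite inE -[in RHS](def_pblock tiP c_iso rep_c).
  have [Wc | nWc] := boolP (W \in cyclic_submodules _).
    have := pblock_equivalence_partition module_iso_equivalence (cyc_c _ rep_c) Wc.
    by move=> <-.
  rewrite (def_pblock tiP c_iso rep_c) /=; apply/esym/negbTE.
  by apply: contra nWc; apply: cyc_c.
rewrite cE big_enum /=.
(* The power with exponent [#|c|] is spread into a product over [W] in [c] of factors that still
   refer to [rep c]. *)
transitivity (\prod_(W in c) \prod_(rho | factors_through (rep c) rho)
                 ('X - (lambda Q alpha (rep c) rho)%:P)).
  rewrite prodr_const -prodrXl; apply: eq_big => [rho | rho _]; first by rewrite inE.
  by rewrite big_nseq iter_mulr_1.
apply: eq_bigr => W Wc.
have : W \in [set W in cyclic_submodules (dual C V) | module_iso (rep c) W].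
  by rewrite cE.
rewrite inE; have /imsetP[x _ ->] := cyc_c _ rep_c.
case/andP=> /imsetP[y _ ->] /module_iso_cycP annE.
apply: eq_big => [rho | rho _]; first exact: eq_ann_factors.
by rewrite (eq_ann_lambda _ annE).
Qed.

End Walk.

Theorem theorem4p6 (K : realType) (R : finComPzRingType) (V : finModType R)
    (Q : R -> K) (alpha : K)
    (rep : {set {set dual K[i] V}} -> {set dual K[i] V}) :
  is_probability Q ->
  0 <= alpha <= 1 ->
  (forall c, c \in iso_classes (dual K[i] V) -> rep c \in c) ->
  perm_eq
    (eigenvalue_seq
       (map_mx (real_complex K)
          (transition_matrix (coin_toss_step (@uniform K V) Q alpha))))
    (predicted_eigenvalues Q alpha rep).
Proof.
(* A multiset is determined by the product of its linear factors; here both products are the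
   characteristic polynomial. *)
move=> [_ Q_sum] _ repP; apply: prod_XsubC_eq.
rewrite (predicted_product _ _ repP) -(char_poly_walk V alpha Q_sum) /eigenvalue_seq.
case: closed_field_poly_normal => s /= ->.
by rewrite (monicP (char_poly_monic _)) scale1r.
Qed.
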